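(* Let $L,M,N$ be positive integers, let $0<A\le B<\infty$, and let $g:=\{g_l\}_{l\in\mathbb{N}_L}\subset\ell_0(\mathbb{Z}\times\mathbb{Z},\mathbb{R})$ be such that for all $l\in\mathbb{N}_L$, $|supp(g_l)|<M$. Then the following statements are equivalent: 1. $\mathcal{G}(g,L,M,N)$ is a frame for $\ell^2(\mathbb{Z}\times\mathbb{Z},\mathbb{H})$ with frame bounds $A\le B$. 2. For all $k\in\mathbb{Z}^2$, $$\frac{A}{M^2}\le\sum_{l\in\mathbb{N}_L}\left(\mathcal{M}_{g_l}(k)\mathcal{M}_{g_l}^t(k)\right)_{0_{\mathbb{Z}^2},0_{\mathbb{Z}^2}}\le\frac{B}{M^2}.$$ 3. For all $k\in\mathbb{N}_N^2$, $$\frac{A}{M^2}\le\sum_{l\in\mathbb{N}_L}\left(\mathcal{M}_{g_l}(k)\mathcal{M}_{g_l}^t(k)\right)_{0_{\mathbb{Z}^2},0_{\mathbb{Z}^2}}\le\frac{B}{M^2}.$$ If one of these statements holds, the frame operator $S$ of $\mathcal{G}(g,L,M,N)$ is given for all $h\in\ell^2(\mathbb{Z}\times\mathbb{Z},\mathbb{H})$ by $$Sh=M^2\left(\sum_{l\in\mathbb{N}_L}\mathcal{M}_{g_l}(\cdot)\mathcal{M}_{g_l}^t(\cdot)\right)_{0_{\mathbb{Z}^2},0_{\mathbb{Z}^2}}h,$$ and $$S^{-1}h=\frac{1}{M^2\left(\sum_{l\in\mathbb{N}_L}\mathcal{M}_{g_l}(\cdot)\mathcal{M}_{g_l}^t(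\cdot)\right)_{0_{\mathbb{Z}^2},0_{\mathbb{Z}^2}}}\,h.$$
   Context: $\mathbb{H}$ is the algebra of real quaternions with imaginary units $i,j,ij$. For a positive integer $K$, $\mathbb{N}_K:=\{0,1,\dots,K-1\}$. $\ell^2(\mathbb{Z}\times\mathbb{Z},\mathbb{H})$ is the right quaternionic Hilbert space of functions $f:\mathbb{Z}^2\to\mathbb{H}$ with $\sum_{k\in\mathbb{Z}^2}|f(k)|^2<\infty$, with inner product $\langle f,g\rangle=\sum_{k\in\mathbb{Z}^2}\overline{f(k)}\,g(k)$; $\ell_0(\mathbb{Z}\times\mathbb{Z},\mathbb{R})$ is the set of real-valued finitely supported functions on $\mathbb{Z}^2$. For $n\in\mathbb{Z}^2$, $(T_{nN}f)(k)=f(k-nN)$ where $nN=(n_1N,n_2N)$. For $m=(m_1,m_2)\in\mathbb{N}_M^2$, $(E_{\frac mM}f)(k)=e^{2\pi i\frac{m_1}{M}k_1}f(k)e^{2\pi j\frac{m_2}{M}k_2}$, $k=(k_1,k_2)\in\mathbb{Z}^2$. The Gabor system is $\mathcal{G}(g,L,M,N):=\{E_{\frac mM}T_{nN}g_l\}_{l\in\mathbb{N}_L,\,m\in\mathbb{N}_M^2,\,n\in\mathbb{Z}^2}$. It is a frame with frame bounds $A\le B$ (where $0<A\le B<\infty$) if for all $h\in\ell^2(\mathbb{Z}\times\mathbb{Z},\mathbb{H})$: $A\|h\|^2\le\sum_{l\in\mathbb{N}_L}\sum_{n\in\mathbb{Z}^2}\sum_{m\in\mathbb{N}_M^2}|\langle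 E_{\frac mM}T_{nN}g_l,h\rangle|^2\le B\|h\|^2$. Its frame operator is $Sh=\sum_{l\in\mathbb{N}_L}\sum_{n\in\mathbb{Z}^2}\sum_{m\in\mathbb{N}_M^2}E_{\frac mM}T_{nN}g_l\,\langle E_{\frac mM}T_{nN}g_l,h\rangle$. For a finitely supported sequence $f$ on $\mathbb{Z}$, $|supp(f)|:=|\max(supp(f))-\min(supp(f))|$ (taken to be $0$ if $f=0$). For finitely supported $g$ on $\mathbb{Z}^2$, $|supp(g)|:=\max\{\max_{k_2\in\mathbb{Z}}|supp(g(\cdot,k_2))|,\ \max_{k_1\in\mathbb{Z}}|supp(g(k_1,\cdot))|\}$. For $h\in\ell^2(\mathbb{Z}\times\mathbb{Z},\mathbb{H})$ and $k\in\mathbb{Z}^2$, $\mathcal{M}_h(k)$ is the matrix indexed by $\mathbb{Z}^2\times\mathbb{Z}^2$ with entries $(\mathcal{M}_h(k))_{p,n}=h(k+pM-nN)$, $p,n\in\mathbb{Z}^2$; $^t$ denotes transpose, so $(\mathcal{M}_{g_l}(k)\mathcal{M}_{g_l}^t(k))_{0_{\mathbb{Z}^2},0_{\mathbb{Z}^2}}=\sum_{n\in\mathbb{Z}^2}g_l(k-nN)^2$. $0_{\mathbb{Z}^2}=(0,0)$. The products in the formulas for $Sh$ and $S^{-1}h$ are pointwise.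
   Formalization: Added hypothesis: for each l, no two points of supp(g_l) differing in both coordinates are congruent modulo M; without it the claim fails, e.g. L=M=N=1, A=B=2, g equal to 1 at (0,0) and (1,1) and 0 elsewhere. *)

(* Defs.v *)
From HB Require Import structures.
From mathcomp Require Import all_boot all_order all_algebra finmap ring.
From mathcomp Require Import boolp classical_sets functions cardinality fsbigop.
From mathcomp Require Import reals ereal esum trigo.

Set Implicit Arguments.
Unset Strict Implicit.
Unset Printing Implicit Defensive.

Import Order.TTheory GRing.Theory Num.Theory.
Local Open Scope classical_set_scope.
Local Open Scope ring_scope.

(* [Quat a b c d] is a + b i + c j + d ij. *)
Record quat (R : Type) := Quat { qre : R; qi : R; qj : R; qij : R }.

Section QuatChoice.
Variable R : choiceType.

Definition tuple_of_quat (q : quat R) : R * R * R * R :=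
  (qre q, qi q, qj q, qij q).
Definition quat_of_tuple (t : R * R * R * R) : quat R :=
  let: (a, b, c, d) := t in Quat a b c d.

Lemma tuple_of_quatK : cancel tuple_of_quat quat_of_tuple.
Proof. by case. Qed.

HB.instance Definition _ := Choice.copy (quat R) (can_type tuple_of_quatK).

End QuatChoice.

Section QuatRing.
Variable R : comNzRingType.

Definition addq (x y : quat R) : quat R :=
  Quat (qre x + qre y) (qi x + qi y) (qj x + qj y) (qij x + qij y).
Definition oppq (x : quat R) : quat R :=
  Quat (- qre x) (- qi x) (- qj x) (- qij x).
Definition mulq (x y : quat R) : quat R :=
  Quat (qre x * qre y - qi x * qi y - qj x * qj y - qij x * qij y)
       (qre x * qi y + qi x * qre y + qj x * qij y - qij x * qj y)
       (qre x * qj y - qi x * qij y + qj x * qre y + qij x * qi y)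
       (qre x * qij y + qi x * qj y - qj x * qi y + qij x * qre y).

Lemma addqA : associative addq.
Proof. by move=> [? ? ? ?] [? ? ? ?] [? ? ? ?]; rewrite /addq /= !addrA. Qed.
Lemma addqC : commutative addq.
Proof. by move=> [? ? ? ?] [? ? ? ?]; congr Quat; rewrite /= addrC. Qed.
Lemma add0q : left_id (Quat 0 0 0 0) addq.
Proof. by move=> [? ? ? ?]; rewrite /addq /= !add0r. Qed.
Lemma addNq : left_inverse (Quat 0 0 0 0) oppq addq.
Proof. by move=> [? ? ? ?]; rewrite /addq /= !addNr. Qed.

HB.instance Definition _ :=
  GRing.isZmodule.Build (quat R) addqA addqC add0q addNq.

Lemma mulqA : associative mulq.
Proof. by move=> [? ? ? ?] [? ? ? ?] [? ? ? ?]; congr Quat => /=; ring. Qed.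
Lemma mul1q : left_id (Quat 1 0 0 0) mulq.
Proof. by move=> [? ? ? ?]; congr Quat => /=; ring. Qed.
Lemma mulq1 : right_id (Quat 1 0 0 0) mulq.
Proof. by move=> [? ? ? ?]; congr Quat => /=; ring. Qed.
Lemma mulqDl : left_distributive mulq (@GRing.add (quat R)).
Proof. by move=> [? ? ? ?] [? ? ? ?] [? ? ? ?]; congr Quat => /=; ring. Qed.
Lemma mulqDr : right_distributive mulq (@GRing.add (quat R)).
Proof. by move=> [? ? ? ?] [? ? ? ?] [? ? ? ?]; congr Quat => /=; ring. Qed.
Lemma oneq_neq0 : Quat 1 0 0 0 != 0 :> quat R.
Proof. by apply/eqP => -[] /eqP; rewrite oner_eq0. Qed.

HB.instance Definition _ := GRing.Zmodule_isNzRing.Build (quat R)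
  mulqA mul1q mulq1 mulqDl mulqDr oneq_neq0.

Definition qreal (a : R) : quat R := Quat a 0 0 0.

Definition qconj (q : quat R) : quat R :=
  Quat (qre q) (- qi q) (- qj q) (- qij q).

End QuatRing.

Definition qabs (R : rcfType) (q : quat R) : R :=
  Num.sqrt (qre q ^+ 2 + qi q ^+ 2 + qj q ^+ 2 + qij q ^+ 2).

Definition qexpi (R : realType) (t : R) : quat R := Quat (cos t) (sin t) 0 0.
Definition qexpj (R : realType) (t : R) : quat R := Quat (cos t) 0 (sin t) 0.

Notation Z2 := (int * int)%type.

Definition Z2_of_ord (K : nat) (k : 'I_K * 'I_K) : Z2 :=
  ((k.1 : nat)%:Z, (k.2 : nat)%:Z).

Section L2.
Variable R : realType.
Implicit Types f g h : Z2 -> quat R.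

(* The squared norm of any function; it is +oo outside of l^2. *)
Definition l2normsq f : \bar R :=
  \esum_(k in [set: Z2]) (qabs (f k) ^+ 2)%:E.

Definition ell2 : set (Z2 -> quat R) := [set f | (l2normsq f < +oo)%E].

(* Unconditional convergence of the series of the [a i] to [s], the distance
   being measured by the squared norm [nsq]. *)
Definition has_usum (I : choiceType) (V : zmodType) (nsq : V -> \bar R)
    (a : I -> V) (s : V) : Prop :=
  forall e : R, 0 < e -> exists F0 : {fset I}, forall F : {fset I},
    (F0 `<=` F)%fset -> (nsq (\sum_(i <- F) a i - s)%R < e%:E)%E.

(* The (unique) unconditional sum, or 0 if the series does not converge. *)
Definition usum (I : choiceType) (V : zmodType) (nsq : V -> \bar R)
    (a : I -> V) : V :=
  xget 0 [set s | has_usum nsq a s].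

Definition inner f g : quat R :=
  usum (fun q => (qabs q ^+ 2)%:E) (fun k : Z2 => qconj (f k) * g k).

Definition translation (N : nat) (n : Z2) f : Z2 -> quat R :=
  fun k => f (k - n *+ N).

Definition modulation (M : nat) (m : 'I_M * 'I_M) f : Z2 -> quat R :=
  fun k => qexpi (2 * pi * (m.1%:R / M%:R) * k.1%:~R) * f k
           * qexpj (2 * pi * (m.2%:R / M%:R) * k.2%:~R).

Definition gabor (L M N : nat) (g : 'I_L -> Z2 -> quat R)
    (x : 'I_L * Z2 * ('I_M * 'I_M)) : Z2 -> quat R :=
  let: (l, n, m) := x in modulation m (translation N n (g l)).

Definition gabor_frame (L M N : nat) (g : 'I_L -> Z2 -> quat R) (A B : R) :
    Prop :=
  forall h, ell2 h ->
    let E := (\sum_(l < L) \esum_(n in [set: Z2]) \sum_(m : 'I_M * 'I_M)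
                (qabs (inner (gabor N g (l, n, m)) h) ^+ 2)%:E)%E in
    (A%:E * l2normsq h <= E)%E /\ (E <= B%:E * l2normsq h)%E.

(* The series converges unconditionally in l^2. *)
Definition frame_op (L M N : nat) (g : 'I_L -> Z2 -> quat R) h :
    Z2 -> quat R :=
  usum l2normsq (fun x : 'I_L * Z2 * ('I_M * 'I_M) =>
    (fun k => gabor N g x k * inner (gabor N g x) h) : Z2 -> quat R).

End L2.

(* The largest and smallest elements of a finite set of integers; both are 0
   by convention for the empty set. *)
Definition zmax (A : set int) : int := xget 0 (A `&` ubound A).
Definition zmin (A : set int) : int := xget 0 (A `&` lbound A).

Definition supp (T : Type) (V : zmodType) (f : T -> V) : set T :=
  [set k | f k != 0].

Definition supp_len (V : zmodType) (f : int -> V) : int :=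
  `|zmax (supp f) - zmin (supp f)|.

Definition supp_len2 (V : zmodType) (g : Z2 -> V) : int :=
  Order.max (zmax [set supp_len (fun k1 => g (k1, k2)) | k2 in [set: int]])
            (zmax [set supp_len (fun k2 => g (k1, k2)) | k1 in [set: int]]).

(* Matrices indexed by Z^2 x Z^2. The sum in [zmulmx] is restricted to rows
   having finitely many nonzero products, which is the case for the rows of
   [gabor_mx] when [h] is finitely supported and [N] is positive. *)
Definition zmatrix (V : Type) := Z2 -> Z2 -> V.

Definition zmulmx (V : nzRingType) (P Q : zmatrix V) : zmatrix V :=
  fun p q => \sum_(n \in [set: Z2]) P p n * Q n q.

Definition ztrmx (V : Type) (P : zmatrix V) : zmatrix V := fun p n => P n p.

Definition gabor_mx (V : Type) (M N : nat) (h : Z2 -> V) (k : Z2) : zmatrix V :=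
  fun p n => h (k + p *+ M - n *+ N).

Definition gram_diag (R : realType) (L M N : nat) (g : 'I_L -> Z2 -> R)
    (k : Z2) : R :=
  \sum_(l < L)
    zmulmx (gabor_mx M N (g l) k) (ztrmx (gabor_mx M N (g l) k)) 0 0.

(* [supp_len2 g < M] only bounds the lengths of the rows and of the columns of
   the support: it does not prevent the support from containing two points that
   differ in both coordinates and are congruent modulo [M]. For such [g] the
   bounds on [gram_diag] do not imply the frame inequalities: for
   L = M = N = 1 and g = 1 on {(0, 0), (1, 1)} and 0 elsewhere, [gram_diag] is
   constantly 2 but the optimal upper frame bound is 4 and the optimal lower
   one is 0. *)
Definition no_diagonal_overlap (V : zmodType) (M : nat) (g : Z2 -> V) : Prop :=
  forall k p : Z2, p.1 != 0 -> p.2 != 0 ->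
    ~ (supp g k /\ supp g (k + p *+ M)).

(* Main.v *)
(* Write phi_m(k) = e^(2 pi i m_1 k_1 / M) a(k) e^(2 pi j m_2 k_2 / M) with
   a(k) = g_l(k - n N). Summing over m_2 first and over m_1 next, the
   orthogonality of characters turns the sum of the phi_m(k) conj(phi_m(k'))
   into M^2 a(k) a(k') if k = k' mod M, and 0 otherwise. The hypotheses on the
   supports make the points of supp a pairwise incongruent mod M, so this kernel
   is M^2 a(k)^2 [k = k']. Hence the frame energy of h is the sum of the
   M^2 w(k) |h(k)|^2, and the frame operator is, pointwise, the multiplication
   by M^2 w. Testing the energy on the indicator of a point gives the bounds on
   w. The frame series converges unconditionally because, at each point k, a
   bounded number of atoms do not vanish, so that all partial sums are dominated
   by a fixed summable function of k. *)

From HB Require Import structures.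
Require Import Defs.
From mathcomp Require Import all_boot all_order all_algebra finmap zify ring lra.
From mathcomp Require Import boolp classical_sets functions cardinality fsbigop.
From mathcomp Require Import reals ereal esum trigo.

Set Implicit Arguments.
Unset Strict Implicit.
Unset Printing Implicit Defensive.

Import Order.TTheory GRing.Theory Num.Theory.
Local Open Scope classical_set_scope.
Local Open Scope ring_scope.

(** * Quaternions *)

Section QuatTheory.
Variable R : comNzRingType.
Implicit Types x y : quat R.

(** The square of [qabs] without the root: identities between norms become polynomial and are
    settled by [ring]. *)
Definition qnormsq x : R := qre x ^+ 2 + qi x ^+ 2 + qj x ^+ 2 + qij x ^+ 2.

Lemma qeqP x y : qre x = qre y -> qi x = qi y -> qj x = qj y ->
  qij x = qij y -> x = y.
Proof. by case: x y => [? ? ? ?] [? ? ? ?] /= -> -> -> ->. Qed.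

Lemma qreal_is_zmod : zmod_morphism (@qreal R).
Proof. by move=> a b; apply: qeqP => /=; ring. Qed.
HB.instance Definition _ :=
  GRing.isZmodMorphism.Build R (quat R) (@qreal R) qreal_is_zmod.

Lemma qreal_is_monoid : monoid_morphism (@qreal R).
Proof. by split=> // a b; apply: qeqP => /=; ring. Qed.
HB.instance Definition _ :=
  GRing.isMonoidMorphism.Build R (quat R) (@qreal R) qreal_is_monoid.

Lemma qreal_inj : injective (@qreal R).
Proof. by move=> a b []. Qed.

Lemma qreal_comm (a : R) x : qreal a * x = x * qreal a.
Proof. by apply: qeqP => /=; ring. Qed.

Lemma qconj_is_zmod : zmod_morphism (@qconj R).
Proof. by move=> x y; apply: qeqP => /=; ring. Qed.
HB.instance Definition _ :=
  GRing.isZmodMorphism.Build (quat R) (quat R) (@qconj R) qconj_is_zmod.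

Lemma qconjK : involutive (@qconj R).
Proof. by move=> x; apply: qeqP => /=; ring. Qed.

Lemma qconjM x y : qconj (x * y) = qconj y * qconj x.
Proof. by apply: qeqP => /=; ring. Qed.

Lemma qconj_real (a : R) : qconj (qreal a) = qreal a.
Proof. by apply: qeqP => /=; ring. Qed.

Lemma mulqconjq x : qconj x * x = qreal (qnormsq x).
Proof. by rewrite /qnormsq; apply: qeqP => /=; ring. Qed.

Lemma qnormsqM x y : qnormsq (x * y) = qnormsq x * qnormsq y.
Proof. by rewrite /qnormsq /=; ring. Qed.

Lemma qnormsqN x : qnormsq (- x) = qnormsq x.
Proof. by rewrite /qnormsq /=; ring. Qed.

Lemma qnormsq_real (a : R) : qnormsq (qreal a) = a ^+ 2.
Proof. by rewrite /qnormsq /=; ring. Qed.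

Lemma qnormsq0 : qnormsq (0 : quat R) = 0.
Proof. by rewrite -[0 in LHS](rmorph0 (@qreal R)) qnormsq_real expr0n. Qed.

End QuatTheory.

Section QuatNorm.
Variable R : realType.
Implicit Types x y : quat R.

Lemma qnormsqE x :
  qnormsq x = qre x ^+ 2 + qi x ^+ 2 + qj x ^+ 2 + qij x ^+ 2.
Proof. by []. Qed.

Lemma qnormsq_ge0 x : 0 <= qnormsq x.
Proof. by rewrite qnormsqE !addr_ge0// sqr_ge0. Qed.

Lemma qabs_sqr x : qabs x ^+ 2 = qnormsq x.
Proof. exact/sqr_sqrtr/qnormsq_ge0. Qed.

Lemma qnormsq_eq0 x : qnormsq x = 0 -> x = 0.
Proof.
case: x => a b c d; rewrite qnormsqE /= => x0.
move/eqP: x0; rewrite !paddr_eq0 ?addr_ge0 ?sqr_ge0// !sqrf_eq0.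
by move=> /andP[/andP[/andP[/eqP-> /eqP->] /eqP->] /eqP->].
Qed.

(** Parallelogram law, with the norm of x - y dropped. *)
Lemma qnormsqD_le x y : qnormsq (x + y) <= 2 * (qnormsq x + qnormsq y).
Proof.
have -> : 2 * (qnormsq x + qnormsq y) = qnormsq (x + y) + qnormsq (x - y).
  by case: x y => [a b c d] [a' b' c' d']; rewrite !qnormsqE /=; ring.
by rewrite lerDl qnormsq_ge0.
Qed.

Lemma qnormsqB_le x y : qnormsq (x - y) <= 2 * (qnormsq x + qnormsq y).
Proof. by rewrite (le_trans (qnormsqD_le _ _))// qnormsqN. Qed.

(* Cauchy-Schwarz would give [size r] for the constant; any bound depending only
   on the number of terms is enough for the domination below. *)
Lemma qnormsq_sum_le (I : Type) (r : seq I) (F : I -> quat R) :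
  qnormsq (\sum_(i <- r) F i) <= 2 ^+ size r * \sum_(i <- r) qnormsq (F i).
Proof.
elim: r => [|i r IHr]; first by rewrite !big_nil qnormsq0 mulr0.
rewrite !big_cons /= exprS (le_trans (qnormsqD_le _ _))// -mulrA.
rewrite ler_wpM2l// mulrDr lerD// ler_peMl ?qnormsq_ge0//.
by rewrite exprn_ege1// ler1n.
Qed.

(** The bound depends on [r] alone, so it is uniform over all partial sums [A] of a series whose
    nonzero terms lie in [r]. *)
Lemma qnormsq_sum_subset (I : choiceType) (r : seq I) (A : {fset I})
    (F : I -> quat R) :
  {in A, forall i, F i != 0 -> i \in r} -> uniq r ->
  qnormsq (\sum_(i <- A) F i) <= 2 ^+ size r * \sum_(i <- r) qnormsq (F i).
Proof.
move=> Ar ur.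
rewrite (bigID (fun i => i \in r)) /= [X in _ + X]big_seq_cond.
rewrite [X in _ + X]big1 ?addr0; last first.
  by move=> i /andP[iA ir]; apply/eqP; apply: contraNT ir; exact: Ar.
rewrite -big_filter; set s := [seq i <- A | i \in r].
have us : uniq s by rewrite filter_uniq.
have ss : {subset s <= r} by move=> i; rewrite mem_filter => /andP[].
rewrite (le_trans (qnormsq_sum_le _ _))// ler_pM ?exprn_ge0 ?sumr_ge0//.
- by move=> i _; exact: qnormsq_ge0.
- by rewrite ler_weXn2l ?ler1n// uniq_leq_size.
rewrite [leRHS](bigID (fun i => i \in s)) /= -[X in X + _]big_filter.
rewrite (perm_big [seq i <- r | i \in s]); last first.
  apply: uniq_perm => //; first exact: filter_uniq.
  by move=> i; rewrite mem_filter; case: (boolP (i \in s)) => // /ss ->.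
by rewrite lerDl sumr_ge0// => i _; exact: qnormsq_ge0.
Qed.

End QuatNorm.

(** * Orthogonality of the characters with values in the quaternions *)

Section Characters.
Variable R : realType.

Lemma qexpiD (s t : R) : qexpi (s + t) = qexpi s * qexpi t.
Proof. by apply: qeqP => /=; rewrite ?cosD ?sinD; ring. Qed.

Lemma qexpjD (s t : R) : qexpj (s + t) = qexpj s * qexpj t.
Proof. by apply: qeqP => /=; rewrite ?cosD ?sinD; ring. Qed.

Lemma qconj_expi (t : R) : qconj (qexpi t) = qexpi (- t).
Proof. by apply: qeqP => /=; rewrite ?cosN ?sinN ?oppr0. Qed.

Lemma qconj_expj (t : R) : qconj (qexpj t) = qexpj (- t).
Proof. by apply: qeqP => /=; rewrite ?cosN ?sinN ?oppr0. Qed.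

Lemma qnormsq_expi (t : R) : qnormsq (qexpi t) = 1.
Proof. by rewrite qnormsqE /= expr0n /= !addr0 cos2Dsin2. Qed.

Lemma qnormsq_expj (t : R) : qnormsq (qexpj t) = 1.
Proof. by rewrite qnormsqE /= expr0n /= !addr0 cos2Dsin2. Qed.

(** Half-angle formula: cos t = 1 - 2 sin(t/2)^2, and t/2 lies strictly between 0 and pi. *)
Lemma cos_lt1 (t : R) : 0 < t < 2 * pi -> cos t < 1.
Proof.
move=> /andP[t0 t2]; have -> : t = (t / 2) *+ 2 by rewrite -mulr_natr divfK.
have : 0 < sin (t / 2).
  by apply: sin_gt0_pi; rewrite divr_gt0//= ltr_pdivrMr// mulrC.
by move=> s0; have := cos2Dsin2 (t / 2); rewrite cos_mulr2n; nra.
Qed.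

(** [e] stands for [qexpi] as well as for [qexpj], so that orthogonality is proved once for both. *)
Variable e : R -> quat R.
Hypothesis eD : forall s t, e (s + t) = e s * e t.
Hypothesis re_e : forall t, qre (e t) = cos t.
Hypothesis qnormsq_e : forall t, qnormsq (e t) = 1.

(** A quaternion of norm 1 whose real part is 1 has no room left for an imaginary part. *)
Let qexp_cos1 t : cos t = 1 -> e t = 1.
Proof.
move=> t1; have := qnormsq_e t; have := re_e t; rewrite t1.
case: (e t) => a b c d /= ->; rewrite qnormsqE /= expr1n.
rewrite -!addrA => /eqP; rewrite -subr_eq0 addrAC subrr add0r.
rewrite !paddr_eq0 ?addr_ge0 ?sqr_ge0// !sqrf_eq0.
by move=> /and3P[/eqP-> /eqP-> /eqP->].
Qed.

Let qexp0 : e 0 = 1.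
Proof. by apply: qexp_cos1; rewrite cos0. Qed.

Let qexpMn t n : e (t *+ n) = e t ^+ n.
Proof. by elim: n => [|n IHn]; rewrite ?mulr0n// mulrS exprS eD IHn. Qed.

Let qexp2pi : e (2 * pi) = 1.
Proof. by apply: qexp_cos1; rewrite mulr_natl cos2pi. Qed.

Let qexp2piz (d : int) : e (2 * pi * d%:~R) = 1.
Proof.
case: d => n.
  by rewrite -[Posz n]/(n%:Z) -pmulrn mulr_natr qexpMn qexp2pi expr1n.
have H : e (2 * pi * n.+1%:R) = 1 by rewrite mulr_natr qexpMn qexp2pi expr1n.
by rewrite NegzE mulrNz -pmulrn -[LHS]mul1r -H mulrN -eD subrr qexp0.
Qed.

(** Geometric sum: the terms are the powers of z = e(2 pi d / M), and z^M = 1. If M divides d then z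
    = 1; otherwise z differs from 1 while (z - 1) annihilates the sum. *)
Lemma sum_qexp (M : nat) (d : int) : (0 < M)%N ->
  \sum_(m < M) e (2 * pi * (m%:R / M%:R) * d%:~R) =
  qreal (if (M%:Z %| d)%Z then M%:R else 0).
Proof.
move=> M0; have MN0 : M%:R != 0 :> R by rewrite pnatr_eq0 -lt0n.
pose z := e (2 * pi * (d%:~R / M%:R)).
transitivity (\sum_(m < M) z ^+ m).
  by apply: eq_bigr => m _; rewrite -qexpMn -mulr_natr; congr e; field.
case: ifPn => [/dvdzP[c dE]|Nd].
  have -> : z = 1 by rewrite /z dE intrM -pmulrn mulfK// qexp2piz.
  rewrite (eq_bigr (fun=> 1)) => [|i _]; rewrite ?expr1n//.
  by rewrite sumr_const card_ord rmorph_nat.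
have zM : z ^+ M = 1.
  by rewrite /z -qexpMn -[_ *+ M]mulr_natr -(mulrA (2 * pi)) divfK// qexp2piz.
have z1 : z != 1.
  (* With r = d mod M, z is e(2 pi r / M), whose real part cos(2 pi r / M) is less than 1 because 0
     < r < M. *)
  rewrite /z {1}(divz_eq d M) intrD intrM -(pmulrn 1 M).
  rewrite [_ / M%:R]mulrDl mulfK// mulrDr eD qexp2piz mul1r.
  apply/eqP => /(congr1 (@qre R)); rewrite re_e /= => /eqP.
  rewrite lt_eqF// cos_lt1//.
  have rM : (d %% M)%Z%:~R < M%:R :> R by rewrite pmulrn ltr_int ltz_pmod.
  have r0 : 0 < (d %% M)%Z%:~R :> R.
    rewrite ltr0z lt_def modz_ge0 ?andbT; last by rewrite eqz_nat -lt0n.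
    by apply: contra Nd => /eqP d0; apply/dvdz_mod0P.
  have M0' : 0 < M%:R :> R by rewrite ltr0n.
  have p0 := pi_gt0 R.
  rewrite !mulr_gt0 ?invr_gt0//=.
  by rewrite gtr_pMr ?mulr_gt0// ltr_pdivrMr// mul1r.
(* Multiplicativity of [qnormsq] rules out zero divisors. *)
rewrite (rmorph0 (@qreal R)); apply: qnormsq_eq0.
have : qnormsq ((z - 1) * \sum_(i < M) z ^+ i) = 0.
  by rewrite -subrX1 zM subrr qnormsq0.
rewrite qnormsqM => /eqP; rewrite mulf_eq0 => /orP[/eqP/qnormsq_eq0/eqP|/eqP//].
by rewrite subr_eq0 (negPf z1).
Qed.

End Characters.

(** * Sums over countable sets *)

Lemma eq_sum_subset (I : eqType) (V : nmodType) (r s : seq I) (a : I -> V) :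
  uniq r -> uniq s -> {subset r <= s} -> (forall i, i \notin r -> a i = 0) ->
  \sum_(i <- s) a i = \sum_(i <- r) a i.
Proof.
move=> ur us rs a0; rewrite (bigID (fun i => i \in r)) /=.
rewrite [X in _ + X]big1 ?addr0// -big_filter.
apply: perm_big; apply: uniq_perm => //; first exact: filter_uniq.
by move=> i; rewrite mem_filter; case: (boolP (i \in r)) => // /rs ->.
Qed.

Section Esum.
Variable R : realType.
Implicit Types (T : choiceType).
Local Open Scope ereal_scope.

Lemma esum_ge_seq T (r : seq T) (a : T -> \bar R) : uniq r ->
  \sum_(i <- r) a i <= \esum_(i in [set: T]) a i.
Proof.
by move=> ur; apply: esum_ge; exists [set` r]; [split | rewrite -fsbig_seq].
Qed.

Lemma esum_seq T (r : seq T) (a : T -> \bar R) : uniq r ->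
  (forall i, 0 <= a i) -> (forall i, i \notin r -> a i = 0) ->
  \esum_(i in [set: T]) a i = \sum_(i <- r) a i.
Proof.
move=> ur a0 ar; rewrite (esumID [set` r])// !setTI [X in _ + X]esum1 ?adde0.
  by rewrite esum_fset// -fsbig_seq.
by move=> i /= /negP; exact: ar.
Qed.

Lemma esum_fin (T : finType) (a : T -> \bar R) :
  (forall i, 0 <= a i) -> \esum_(i in [set: T]) a i = \sum_i a i.
Proof.
by move=> a0; apply: esum_seq => // [|i]; rewrite ?index_enum_uniq ?mem_index_enum.
Qed.

Lemma esum_pair (T1 T2 : choiceType) (a : T1 * T2 -> \bar R) :
  (forall x, 0 <= a x) ->
  \esum_(x in [set: T1 * T2]) a x =
  \esum_(i in [set: T1]) \esum_(j in [set: T2]) a (i, j).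
Proof.
move=> a0; rewrite (@esum_esum R T1 T2 setT (fun=> setT) (fun i j => a (i, j)))//.
have -> : [set: T1] `*`` (fun=> [set: T2]) = [set: T1 * T2] by apply/seteqP; split.
by apply: eq_esum => -[].
Qed.

(** Tonelli: both sides are the sum over the product, up to swapping the coordinates. *)
Lemma exchange_esum (T1 T2 : choiceType) (a : T1 -> T2 -> \bar R) :
  (forall i j, 0 <= a i j) ->
  \esum_(i in [set: T1]) \esum_(j in [set: T2]) a i j =
  \esum_(j in [set: T2]) \esum_(i in [set: T1]) a i j.
Proof.
move=> a0.
rewrite -(@esum_pair _ _ (fun x => a x.1 x.2))//.
rewrite -(@esum_pair _ _ (fun x => a x.2 x.1))//.
rewrite (@reindex_esum R _ _ setT setT (fun x : T2 * T1 => (x.2, x.1)))//.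
split=> //; first by move=> [? ?] [? ?] _ _ /= [-> ->].
by move=> [i j] _; exists (j, i).
Qed.

(** One inequality holds for every nonnegative constant; for c > 0 the other follows from it with
    c^-1 and the scaled terms. For c = 0 the convention 0 * oo = 0 is used. *)
Lemma esumZl T (D : set T) (c : R) (a : T -> \bar R) : (0 <= c)%R ->
  (forall i, 0 <= a i) ->
  \esum_(i in D) (c%:E * a i) = c%:E * \esum_(i in D) a i.
Proof.
have le_esumZl (b : R) (f : T -> \bar R) : (0 <= b)%R -> (forall i, 0 <= f i) ->
    \esum_(i in D) (b%:E * f i) <= b%:E * \esum_(i in D) f i.
  move=> b0 f0; apply: ge_ereal_sup => _ [X [finX XD]] <-.
  rewrite -ge0_mule_fsumr// lee_wpmul2l// ?lee_fin//.
  by apply: esum_ge; exists X.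
rewrite le_eqVlt => /predU1P[<- a0|c0 a0].
  by rewrite mul0e esum1// => i _; rewrite mul0e.
apply/eqP; rewrite eq_le le_esumZl ?(ltW c0)//=.
have -> : \esum_(i in D) a i = \esum_(i in D) ((c^-1)%:E * (c%:E * a i)).
  by apply: eq_esum => i _; rewrite muleA -EFinM mulVf ?gt_eqF// mul1e.
have ca0 i : 0 <= c%:E * a i by rewrite mule_ge0// lee_fin ltW.
apply: (@le_trans _ _ (c%:E * ((c^-1)%:E * \esum_(i in D) (c%:E * a i)))).
  by rewrite lee_wpmul2l ?lee_fin ?(ltW c0)// le_esumZl// invr_ge0 ltW.
by rewrite muleA -EFinM mulfV ?gt_eqF// mul1e.
Qed.

(** Some finite partial sum comes within e of the supremum, and the tail is what remains. *)
Lemma esum_tail T (a : T -> \bar R) (e : R) : (forall i, 0 <= a i) ->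
  \esum_(i in [set: T]) a i < +oo -> (0 < e)%R ->
  exists K : {fset T}, \esum_(i in ~` [set` K]) a i < e%:E.
Proof.
move=> a0 afin e0.
have sfin : \esum_(i in [set: T]) a i \is a fin_num.
  by rewrite ge0_fin_numE// esum_ge0.
have [_ [X [finX _] <-]] := ub_ereal_sup_adherent e0 sfin.
rewrite -/(\esum_(i in [set: T]) a i) -(esum_fset finX)// => ltX.
have [K XK] : exists K : {fset T}, X = [set` K] by apply/finite_fsetP.
exists K; rewrite -XK; move: sfin ltX; rewrite (esumID X)// !setTI.
rewrite fin_numD lteBlDr// => /andP[fin1 fin2].
by rewrite lteD2lE.
Qed.

End Esum.

(** * Uniqueness of unconditional sums and convergence by domination *)

Section UnconditionalSums.
Variable R : realType.
Implicit Types f h : Z2 -> quat R.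

(** As [nsq] is arbitrary, separation of points is assumed: distinct candidates have disjoint balls
    of a common radius. The partial sum over the union of [F0] and [F1] would lie in both. *)
Lemma usum_eq (I : choiceType) (V : zmodType) (nsq : V -> \bar R)
    (a : I -> V) (s : V) :
  (forall s', s' != s -> exists2 e : R, 0 < e &
    forall x, (nsq (x - s)%R < e%:E)%E -> ~ (nsq (x - s')%R < e%:E)%E) ->
  has_usum nsq a s -> usum nsq a = s.
Proof.
move=> sep as_; apply: xget_unique => //= s' as'; apply/eqP.
apply: contrapT => /negP/sep[e e0 es].
have [F0 F0s] := as_ e e0; have [F1 F1s] := as' e e0.
by apply: (es _ (F0s (F0 `|` F1)%fset _) (F1s (F0 `|` F1)%fset _));
  rewrite ?fsubsetUl ?fsubsetUr.
Qed.

(** The quarter comes from the factor 2 in [qnormsqB_le]: a point common to both balls would give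
    |s' - s|^2 < 2 (e + e). *)
Lemma qnormsq_sep (s s' : quat R) : s' != s ->
  let e := qnormsq (s' - s) / 4 in 0 < e /\
  forall x, qnormsq (x - s) < e -> ~ qnormsq (x - s') < e.
Proof.
move=> ss' e; split.
  rewrite divr_gt0// lt_def qnormsq_ge0 andbT.
  by apply: contra ss' => /eqP/qnormsq_eq0/eqP; rewrite subr_eq0.
move=> x xs xs'.
have : qnormsq (s' - s) <= 2 * (qnormsq (x - s) + qnormsq (x - s')).
  rewrite (_ : s' - s = (x - s) - (x - s')) ?qnormsqB_le//.
  by rewrite opprB [RHS]addrC addrA subrK.
by move: xs xs'; rewrite /e !ltr_pdivlMr//; lra.
Qed.

Lemma inner_seq f h (r : seq Z2) : uniq r -> (forall k, k \notin r -> f k = 0) ->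
  inner f h = \sum_(k <- r) qconj (f k) * h k.
Proof.
move=> ur fr; apply: usum_eq => [s' /qnormsq_sep[e0 es]|e e0].
  by eexists; [exact: e0 | move=> x; rewrite !qabs_sqr !lte_fin; exact: es].
exists [fset k in r]%fset => F rF.
rewrite (eq_sum_subset ur) ?fset_uniq// => [|k kr|k /fr->].
- by rewrite subrr qabs_sqr qnormsq0 lte_fin.
- by apply: (fsubsetP rF); rewrite inE.
- by rewrite raddf0 mul0r.
Qed.

Lemma l2normsqE f : l2normsq f = \esum_(k in [set: Z2]) (qnormsq (f k))%:E.
Proof. by apply: eq_esum => k _; rewrite qabs_sqr. Qed.

Lemma qnormsq_le_l2normsq f k : ((qnormsq (f k))%:E <= l2normsq f)%E.
Proof.
rewrite l2normsqE; apply: le_trans (esum_ge_seq (r := [:: k]) _ _) => //.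
by rewrite big_seq1.
Qed.

(** Two distinct functions differ at some point k, and their values at k are already separated; the
    l^2 norm dominates each value. *)
Lemma usum_l2_eq (I : choiceType) (a : I -> Z2 -> quat R) s :
  has_usum (@l2normsq R) a s -> usum (@l2normsq R) a = s.
Proof.
apply: usum_eq => s' ss'.
have [k] : exists k, s' k != s k.
  apply: contrapT => /forallNP ss; case/eqP: ss'; apply/funext => k.
  by apply/eqP; apply: contrapT => /negP; exact: ss.
move=> /qnormsq_sep[e0 es]; eexists; first exact: e0.
move=> x xs xs'; apply: (es (x k)); rewrite -lte_fin.
  exact: le_lt_trans (qnormsq_le_l2normsq (x - s) k) xs.
exact: le_lt_trans (qnormsq_le_l2normsq (x - s') k) xs'.
Qed.

(** Dominated convergence. Once a partial sum contains every index active on a finite set [K], it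
    agrees with [s] on [K]; off [K] the error is controlled by the tail of [H]. *)
Lemma has_usum_dominated (I : choiceType) (a : I -> Z2 -> quat R)
    (s : Z2 -> quat R) (X : Z2 -> seq I) (H : Z2 -> \bar R) :
  (forall k, uniq (X k)) -> (forall k x, x \notin X k -> a x k = 0) ->
  (forall k, s k = \sum_(x <- X k) a x k) ->
  (forall k (F : {fset I}), ((qnormsq (\sum_(x <- F) a x k))%:E <= H k)%E) ->
  (\esum_(k in [set: Z2]) H k < +oo)%E -> has_usum (@l2normsq R) a s.
Proof.
move=> uX aX sE aH Hfin e e0.
have H0 k : (0 <= H k)%E.
  by apply: le_trans (aH k fset0); rewrite big_nil qnormsq0.
(* Off [K] the squared error is at most 2 (H + H) = 4 H. *)
have e4 : 0 < e / 4 by rewrite divr_gt0.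
have [K HK] := esum_tail H0 Hfin e4.
pose Y k := [fset x in X k]%fset.
(* At each point [s] is itself a partial sum, hence also bounded by [H]. *)
have sumY k : \sum_(x <- Y k) a x k = s k.
  rewrite sE; apply: eq_sum_subset => // [x xX|x]; [by rewrite /Y inE | exact: aX].
exists [fset x in flatten [seq X k | k <- K]]%fset => F FK.
have diffE k : (\sum_(x <- F) a x - s)%R k = \sum_(x <- F) a x k - s k.
  by rewrite fct_sumE.
rewrite l2normsqE (esumID [set` K]) => [|k _]; last by rewrite lee_fin qnormsq_ge0.
rewrite !setTI [X in (X + _)%E]esum1 ?add0e => [|k /= kK]; last first.
  rewrite diffE sE (eq_sum_subset (uX k) (fset_uniq F)) => [|x xX|x]; [|  | exact: aX].
    by rewrite subrr qnormsq0.
  apply: (fsubsetP FK); rewrite inE; apply/flattenP; exists (X k) => //.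
  exact: map_f.
apply: (@le_lt_trans _ _ (\esum_(k in ~` [set` K]) (4%:E * H k)%E)).
  apply: le_esum => k _; rewrite diffE -sumY.
  move: (aH k F) (aH k (Y k)); set u := \sum_(x <- F) _; set v := \sum_(x <- Y k) _.
  case: (H k) => [c| |]; last by rewrite leeNy_eq.
    rewrite -EFinM !lee_fin => uc vc.
    by have := qnormsqB_le u v; lra.
  by move=> _ _; rewrite mulry gtr0_sg// mul1e leey.
by rewrite esumZl// -lte_pdivlMl// -EFinM mulrC.
Qed.

End UnconditionalSums.

(** * Supports *)

(** The relation is a parameter so that the reversed order yields minima. *)
Lemma seq_has_max (T : eqType) (e : rel T) (r : seq T) (x : T) :
  total e -> transitive e -> x \in r ->
  exists2 y, y \in r & {in r, forall z, e z y}.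
Proof.
move=> te tre; have ee y : e y y by have := te y y; rewrite orbb.
elim: r x => [|a r IHr] x //= _.
case: r IHr => [|b r] IHr.
  by exists a; rewrite ?mem_head// => z; rewrite inE => /eqP->.
have [y yr ymax] := IHr b (mem_head _ _).
case/orP: (te a y) => [ay|ya].
  by exists y; [rewrite inE yr orbT|move=> z; rewrite inE => /predU1P[->//|/ymax]].
exists a; first exact: mem_head.
by move=> z; rewrite inE => /predU1P[->//|/ymax zy]; exact: tre ya.
Qed.

Lemma le_zmax (A : set int) (x : int) : finite_set A -> A x -> x <= zmax A.
Proof.
move=> /finite_fsetP[K ->] xK.
have [y yK ymax] := seq_has_max (@le_total _ int) (@le_trans _ int) xK.
suff [_] : ([set` K] `&` ubound [set` K]) (zmax [set` K]) by exact.
by apply: xgetPex; exists y.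
Qed.

Lemma ge_zmin (A : set int) (x : int) : finite_set A -> A x -> zmin A <= x.
Proof.
move=> /finite_fsetP[K ->] xK.
have ge_tot : total (fun a b : int => b <= a) by move=> a b; exact: le_total.
have ge_tr : transitive (fun a b : int => b <= a).
  by move=> a b c ba cb; exact: le_trans cb ba.
have [y yK ymin] := seq_has_max ge_tot ge_tr xK.
suff [_] : ([set` K] `&` lbound [set` K]) (zmin [set` K]) by exact.
by apply: xgetPex; exists y.
Qed.

Section SupportLength.
Variable V : zmodType.

Lemma le_supp_len (f : int -> V) (a b : int) : finite_set (supp f) ->
  supp f a -> supp f b -> `|a - b| <= supp_len f.
Proof.
move=> finf fa fb; have := (le_zmax finf fa, ge_zmin finf fa).
have := (le_zmax finf fb, ge_zmin finf fb) => -[bM mb] [aM ma].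
by rewrite /supp_len; lia.
Qed.

(** Finiteness makes the outer [zmax] in [supp_len2] a true maximum instead of its default 0. *)
Lemma finite_supp_lens (f : int -> int -> V) (D : set int) : finite_set D ->
  (forall k, ~ D k -> f k = fun=> 0) ->
  finite_set [set supp_len (f k) | k in [set: int]].
Proof.
move=> finD fD; pose E := (fun k => supp_len (f k)) @` D `|` [set 0].
apply: (@sub_finite_set _ _ E); last first.
  by rewrite finite_setU; split; [exact: finite_image | exact: finite_set1].
move=> _ [k _ <-]; have [Dk|/fD ->] := pselect (D k); first by left; exists k.
(* On an empty support both [zmax] and [zmin] take the default 0, so the length is 0. *)
right; rewrite /= /supp_len.
have -> : supp (fun=> 0 : V) = set0 :> set int.
  by apply/seteqP; split=> // i /=; rewrite /supp /= eqxx.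
by rewrite /zmax /zmin !set0I subrr normr0.
Qed.

Variable g : Z2 -> V.
Hypothesis g_fin : finite_set (supp g).

Lemma le_supp_len2_row (k2 a b : int) : supp g (a, k2) -> supp g (b, k2) ->
  `|a - b| <= supp_len2 g.
Proof.
move=> ga gb; rewrite /supp_len2 le_max; apply/orP; left.
apply: (@le_trans _ _ (supp_len (fun k1 => g (k1, k2)))).
  apply: le_supp_len => //.
  apply: sub_finite_set (finite_image fst g_fin) => i gi; by exists (i, k2).
apply: le_zmax; last by exists k2.
apply: finite_supp_lens (finite_image snd g_fin) _ => k Dk.
apply/funext => i; apply/eqP; apply: contrapT => /negP gi.
by apply: Dk; exists (i, k).
Qed.

Lemma le_supp_len2_col (k1 a b : int) : supp g (k1, a) -> supp g (k1, b) ->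
  `|a - b| <= supp_len2 g.
Proof.
move=> ga gb; rewrite /supp_len2 le_max; apply/orP; right.
apply: (@le_trans _ _ (supp_len (fun k2 => g (k1, k2)))).
  apply: le_supp_len => //.
  apply: sub_finite_set (finite_image snd g_fin) => i gi; by exists (k1, i).
apply: le_zmax; last by exists k1.
have := finite_supp_lens (f := fun k1 k2 => g (k1, k2)) (finite_image fst g_fin).
apply=> k Dk.
apply/funext => i; apply/eqP; apply: contrapT => /negP gi.
by apply: Dk; exists (k, i).
Qed.

(** The two support hypotheses combine here: the length bound excludes congruent points sharing a
    coordinate, and [no_diagonal_overlap] excludes those differing in both. *)
Lemma supp_modz_inj (M : nat) : (0 < M)%N -> supp_len2 g < M%:Z ->
  no_diagonal_overlap M g -> forall k k', supp g k -> supp g k' ->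
  (M%:Z %| k.1 - k'.1)%Z -> (M%:Z %| k.2 - k'.2)%Z -> k = k'.
Proof.
move=> M0 g_len g_diag [k1 k2] [k1' k2'] gk gk' /= /dvdzP[p1 E1] /dvdzP[p2 E2].
have E1' : k1 = k1' + p1 * M by lia.
have E2' : k2 = k2' + p2 * M by lia.
(* A multiple of M of absolute value less than M is 0. *)
have small (p a b : int) : a = b + p * M%:Z -> `|a - b| <= supp_len2 g -> p = 0.
  by move=> -> le_ab; nia.
have [p20|p20] := eqVneq p2 0.
  have k2E : k2 = k2' by lia.
  move: gk; rewrite k2E => gk; congr (_, _).
  by have := small _ _ _ E1' (le_supp_len2_row gk gk') => p0; lia.
have [p10|p10] := eqVneq p1 0.
  have k1E : k1 = k1' by lia.
  move: gk; rewrite k1E => gk; congr (_, _).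
  by have := small _ _ _ E2' (le_supp_len2_col gk gk') => p0; lia.
case: (g_diag (k1', k2') (p1, p2) p10 p20); split=> //.
suff -> : (k1', k2') + (p1, p2) *+ M = (k1, k2) by [].
rewrite E1' E2'; congr (_, _) => /=.
  by rewrite (raddfMn fst) /= -mulr_natr natz.
by rewrite (raddfMn snd) /= -mulr_natr natz.
Qed.

End SupportLength.

(** * Gabor systems *)

Section GaborSystem.
Variables (R : realType) (L M N : nat).
Hypotheses (M_gt0 : (0 < M)%N) (N_gt0 : (0 < N)%N).
Variable g : 'I_L -> Z2 -> R.
Hypotheses (g_fin : forall l, finite_set (supp (g l)))
  (g_len : forall l, supp_len2 (g l) < M%:Z)
  (g_diag : forall l, no_diagonal_overlap M (g l)).

Let gH (l : 'I_L) (k : Z2) : quat R := qreal (g l k).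
Let w : Z2 -> R := gram_diag M N g.
Let gab (l : 'I_L) (n : Z2) (m : 'I_M * 'I_M) : Z2 -> quat R :=
  gabor N gH (l, n, m).
Implicit Types (l : 'I_L) (n k : Z2) (m : 'I_M * 'I_M) (h : Z2 -> quat R).

Lemma qnormsq_gabor l n m k : qnormsq (gab l n m k) = g l (k - n *+ N) ^+ 2.
Proof.
rewrite /gab /= /modulation !qnormsqM qnormsq_expi qnormsq_expj.
by rewrite mul1r mulr1 qnormsq_real.
Qed.

Lemma gabor_kernel l n k k' :
  \sum_m gab l n m k * qconj (gab l n m k') =
  qreal (M%:R ^+ 2 * (g l (k - n *+ N) ^+ 2 * (k == k')%:R)).
Proof.
pose a := g l (k - n *+ N); pose b := g l (k' - n *+ N).
pose ei (m : 'I_M) (d : int) : quat R := qexpi (2 * pi * (m%:R / M%:R) * d%:~R).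
pose ej (m : 'I_M) (d : int) : quat R := qexpj (2 * pi * (m%:R / M%:R) * d%:~R).
have eiB (m : 'I_M) (d d' : int) : ei m d * qconj (ei m d') = ei m (d - d').
  by rewrite /ei qconj_expi -qexpiD -mulrBr -intrB.
have ejB (m : 'I_M) (d d' : int) : ej m d * qconj (ej m d') = ej m (d - d').
  by rewrite /ej qconj_expj -qexpjD -mulrBr -intrB.
have sum_ei d : \sum_m ei m d = qreal (if (M%:Z %| d)%Z then M%:R else 0).
  by apply: sum_qexp => //; [exact: qexpiD | exact: qnormsq_expi].
have sum_ej d : \sum_m ej m d = qreal (if (M%:Z %| d)%Z then M%:R else 0).
  by apply: sum_qexp => //; [exact: qexpjD | exact: qnormsq_expj].
have termE m : gab l n m k * qconj (gab l n m k') =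
    qreal (a * b) * (ei m.1 k.1 * ej m.2 (k.2 - k'.2) * qconj (ei m.1 k'.1)).
  rewrite /gab /= /modulation -/(ei m.1 k.1) -/(ei m.1 k'.1).
  rewrite -/(ej m.2 k.2) -/(ej m.2 k'.2).
  rewrite /translation /gH -/a -/b !qconjM qconj_real -ejB rmorphM /=.
  rewrite -[ei _ k.1 * qreal a]qreal_comm.
  by rewrite -!mulrA; congr (_ * _); rewrite !mulrA -(qreal_comm b) !mulrA.
rewrite (eq_bigr _ (fun m _ => termE m)) -mulr_sumr.
rewrite -(pair_bigA _ (fun m1 m2 : 'I_M =>
  ei m1 k.1 * ej m2 (k.2 - k'.2) * qconj (ei m1 k'.1))) /=.
(* The factors in i surround the factor in j and do not commute with it; they can be joined only
   after the sum over m_2 has made the middle real. *)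
have sum2E (m1 : 'I_M) :
    \sum_(m2 < M) ei m1 k.1 * ej m2 (k.2 - k'.2) * qconj (ei m1 k'.1) =
    qreal (if (M%:Z %| k.2 - k'.2)%Z then M%:R else 0) * ei m1 (k.1 - k'.1).
  by rewrite -mulr_suml -mulr_sumr sum_ej -qreal_comm -mulrA eiB.
rewrite (eq_bigr _ (fun (m1 : 'I_M) _ => sum2E m1)) -mulr_sumr sum_ei -!rmorphM /=.
congr qreal; have [kk'|kk'] := eqVneq k k'.
  by rewrite /a /b kk' !subrr !dvdz0 mulr1 -!expr2 mulrC.
rewrite !mulr0.
have [->|a0] := eqVneq a 0; first by rewrite !mul0r.
have [->|b0] := eqVneq b 0; first by rewrite mulr0 mul0r.
case: ifPn => d2; last by rewrite mul0r mulr0.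
case: ifPn => d1; last by rewrite !mulr0.
(* Here a and b are nonzero and k, k' are congruent mod M, so k - nN and k' - nN are congruent
   points of the support and must coincide. *)
case/eqP: kk'; apply: (@addIr _ (- (n *+ N))).
apply: (supp_modz_inj (g_fin l) M_gt0 (g_len l) (@g_diag l)) => //=.
  by rewrite (_ : _ - _ = k.1 - k'.1)//; ring.
by rewrite (_ : _ - _ = k.2 - k'.2)//; ring.
Qed.

(* All the [g l] vanish outside of the finite set [P]; translations by [n *+ N]
   move it to [shifts n], and [origins k] contains the [n] for which [k] belongs
   to [shifts n]. *)
Let P : seq Z2 :=
  undup (flatten [seq fset_set (supp (g l)) : seq Z2 | l <- enum 'I_L]).
Let shifts n : seq Z2 := [seq q + n *+ N | q <- P].
Let origins k : seq Z2 :=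
  undup [seq ((k.1 - q.1) %/ N%:Z, (k.2 - q.2) %/ N%:Z)%Z | q <- P].

Let mem_P l k : g l k != 0 -> k \in P.
Proof.
move=> gk; rewrite mem_undup; apply/flattenP.
exists (fset_set (supp (g l)) : seq Z2).
  by apply: map_f; rewrite mem_enum.
by rewrite in_fset_set// inE.
Qed.

Let uniq_shifts n : uniq (shifts n).
Proof. by rewrite map_inj_uniq ?undup_uniq//; exact: addIr. Qed.

Let notin_shifts l n k : k \notin shifts n -> g l (k - n *+ N) = 0.
Proof.
move=> kn; apply/eqP; apply: contraNT kn => /mem_P kP.
by apply/mapP; exists (k - n *+ N) => //; rewrite subrK.
Qed.

Let notin_origins l n k : n \notin origins k -> g l (k - n *+ N) = 0.
Proof.
move=> nk; apply/eqP; apply: contraNT nk => /mem_P kP.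
rewrite mem_undup; apply/mapP; exists (k - n *+ N) => //=.
have E1 : (n *+ N).1 = n.1 * N%:Z by rewrite (raddfMn fst) -mulr_natr natz.
have E2 : (n *+ N).2 = n.2 * N%:Z by rewrite (raddfMn snd) -mulr_natr natz.
(* The division defining [origins] is exact when k - q is a multiple of N, and then returns n. *)
have divE (i j : int) : ((i - (i - j * N%:Z)) %/ N%:Z)%Z = j.
  by rewrite opprB addrC subrK mulzK// eqz_nat -lt0n.
by rewrite E1 E2 !divE; case: n {E1 E2 kP}.
Qed.

Lemma inner_gabor l n m h :
  inner (gab l n m) h = \sum_(k <- shifts n) qconj (gab l n m k) * h k.
Proof.
apply: inner_seq => // k /(notin_shifts l) gk; apply: qnormsq_eq0.
by rewrite qnormsq_gabor gk expr0n.
Qed.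

Lemma gabor_reproducing l n h k :
  \sum_m gab l n m k * inner (gab l n m) h =
  qreal (M%:R ^+ 2 * g l (k - n *+ N) ^+ 2) * h k.
Proof.
under eq_bigr => m _.
  rewrite inner_gabor mulr_sumr.
  under eq_bigr do rewrite mulrA.
  over.
rewrite exchange_big /=.
under eq_bigr => k' _ do rewrite -mulr_suml gabor_kernel.
(* The inner product runs over [shifts n] only; for k outside, both sides vanish. *)
have [kn|kn] := boolP (k \in shifts n).
  rewrite (bigD1_seq k)//= eqxx mulr1 big1 ?addr0// => k' /negPf k'k.
  by rewrite eq_sym k'k !mulr0 rmorph0 mul0r.
rewrite (notin_shifts l kn) expr0n /= mulr0 rmorph0 mul0r big1// => k' _.
by rewrite mul0r mulr0 rmorph0 mul0r.
Qed.

(** Through [qreal_inj] the computation takes place in the quaternions, with |c|^2 = conj(c) c. Only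
    conj(c) is expanded, which leaves the sum over m of [gabor_reproducing]. *)
Lemma gabor_energy l n h :
  \sum_m qnormsq (inner (gab l n m) h) =
  \sum_(k <- shifts n) M%:R ^+ 2 * (g l (k - n *+ N) ^+ 2 * qnormsq (h k)).
Proof.
apply: (@qreal_inj R); rewrite !rmorph_sum /=.
under eq_bigr => m _.
  rewrite -mulqconjq {1}inner_gabor raddf_sum mulr_suml /=.
  under eq_bigr do rewrite qconjM qconjK -mulrA.
  over.
rewrite exchange_big /=; apply: eq_bigr => k _.
rewrite -mulr_sumr gabor_reproducing mulrA -qreal_comm -mulrA mulqconjq -rmorphM.
by rewrite mulrA.
Qed.

Lemma gram_diagE k :
  w k = \sum_(l < L) \sum_(n <- origins k) g l (k - n *+ N) ^+ 2.
Proof.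
rewrite /w /gram_diag; apply: eq_bigr => l _.
rewrite /zmulmx /ztrmx /gabor_mx mul0rn addr0.
rewrite (@fsbigTE _ _ _ _ [fset n in origins k]%fset) => [|n]; last first.
  by rewrite inE => /(notin_origins l) ->; rewrite mul0r.
rewrite (@eq_sum_subset _ _ (origins k)) ?undup_uniq ?fset_uniq//.
- by move=> n nk; rewrite inE.
- by move=> n /(notin_origins l) ->; rewrite mul0r.
Qed.

(** Moving k by pN only shifts the summation index by p. *)
Lemma gram_diag_periodic k p : w (k + p *+ N) = w k.
Proof.
rewrite /w /gram_diag; apply: eq_bigr => l _; rewrite /zmulmx /ztrmx /gabor_mx.
rewrite (@reindex_fsbigT _ _ _ _ _ (+%R^~ p)) /=; last first.
  by exists (+%R^~ (- p)) => n; rewrite ?addrK ?subrK.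
apply: eq_fsbigr => n _; rewrite mul0rn !addr0 mulrnDl.
by rewrite opprD addrACA subrr addr0.
Qed.

(** All terms are nonnegative, so the sums over n and k are exchanged in the extended reals for
    arbitrary [h]. *)
Lemma frame_energy h :
  (\sum_(l < L) \esum_(n in [set: Z2])
    \sum_m (qabs (inner (gab l n m) h) ^+ 2)%:E)%E =
  \esum_(k in [set: Z2]) (M%:R ^+ 2 * w k * qnormsq (h k))%:E.
Proof.
pose F l n k := (M%:R ^+ 2 * (g l (k - n *+ N) ^+ 2 * qnormsq (h k)))%:E.
have F0 l n k : (0 <= F l n k)%E.
  by rewrite lee_fin mulr_ge0 ?sqr_ge0// mulr_ge0 ?sqr_ge0// qnormsq_ge0.
transitivity (\sum_(l < L)
    \esum_(n in [set: Z2]) \esum_(k in [set: Z2]) F l n k)%E.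
  apply: eq_bigr => l _; apply: eq_esum => n _.
  rewrite sumEFin; under eq_bigr do rewrite qabs_sqr.
  rewrite gabor_energy -sumEFin (@esum_seq _ _ (shifts n))// => k /(notin_shifts l) gk.
  by rewrite /F gk expr0n /= mul0r mulr0.
transitivity (\sum_(l < L)
    \esum_(k in [set: Z2]) \esum_(n in [set: Z2]) F l n k)%E.
  by apply: eq_bigr => l _; exact: exchange_esum.
rewrite -esum_sum => [|k l _ _]; last exact: esum_ge0.
apply: eq_esum => k _; rewrite gram_diagE mulr_sumr mulr_suml -sumEFin.
apply: eq_bigr => l _.
rewrite (@esum_seq _ _ (origins k)) ?undup_uniq// => [|n /(notin_origins l) gk].
  rewrite sumEFin mulr_sumr mulr_suml; congr EFin.
  by apply: eq_bigr => n _; rewrite mulrA.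
by rewrite /F gk expr0n /= mul0r mulr0.
Qed.

Lemma gram_diag_ge0 k : 0 <= w k.
Proof.
by rewrite gram_diagE sumr_ge0// => l _; rewrite sumr_ge0// => n _; exact: sqr_ge0.
Qed.

(** Modulation and translation preserve the norm; summing over all l' makes the bound independent of
    the atom. *)
Lemma l2normsq_gabor_le l n m :
  (l2normsq (gab l n m) <= (\sum_(l' < L) \sum_(q <- P) g l' q ^+ 2)%:E)%E.
Proof.
rewrite l2normsqE (@esum_seq _ _ (shifts n))//.
- rewrite sumEFin lee_fin big_map (bigD1 l)//=.
  under eq_bigr do rewrite qnormsq_gabor addrK.
  by rewrite lerDl sumr_ge0// => l' _; rewrite sumr_ge0// => q _; exact: sqr_ge0.
- by move=> k; rewrite lee_fin qnormsq_ge0.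
- by move=> k /(notin_shifts l) gk; rewrite qnormsq_gabor gk expr0n.
Qed.

(** Contains the index of every atom that does not vanish at k. Its size is bounded independently of
    k, which yields the constant [C] of the domination below. *)
Let active k : seq ('I_L * Z2 * ('I_M * 'I_M)) :=
  [seq (ln, m) | ln <- [seq (l, n) | l <- enum 'I_L, n <- origins k],
                 m <- enum {: 'I_M * 'I_M}].

Let uniq_active k : uniq (active k).
Proof.
apply: allpairs_uniq; rewrite ?enum_uniq//; last first.
  by move=> [? ?] [? ?] _ _ /= [-> ->].
apply: allpairs_uniq; rewrite ?enum_uniq ?undup_uniq//.
by move=> [? ?] [? ?] _ _ /= [-> ->].
Qed.

Let notin_active k x : x \notin active k -> gabor N gH x k = 0.
Proof.
case: x => [[l n] m] xk; apply: qnormsq_eq0; rewrite qnormsq_gabor.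
rewrite (notin_origins l (n := n)) ?expr0n//; apply: contra xk => nk.
by apply: allpairs_f; rewrite ?mem_enum//; apply: allpairs_f; rewrite ?mem_enum.
Qed.

Let size_active k : (size (active k) <= L * size P * (M * M))%N.
Proof.
rewrite !size_allpairs -!cardE !card_prod !card_ord leq_mul// leq_mul//.
by rewrite (leq_trans (size_undup _))// size_map.
Qed.

(** With c_x the coefficients of h, the dominating function is C times the sum over x of
    |phi_x(k)|^2 |c_x|^2. Summed over k, it is at most C G times the frame energy, itself at most
    M^2 W |h|^2. *)
Lemma frame_op_has_usum (W : R) h : (forall k, w k <= W) -> ell2 h ->
  has_usum (@l2normsq R)
    (fun x : 'I_L * Z2 * ('I_M * 'I_M) =>
      (fun k => gabor N gH x k * inner (gabor N gH x) h) : Z2 -> quat R)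
    (fun k => qreal (M%:R ^+ 2 * w k) * h k).
Proof.
move=> wW h2; pose c (x : 'I_L * Z2 * ('I_M * 'I_M)) := inner (gabor N gH x) h.
(* The constant of [qnormsq_sum_subset] at the size bound of [active]. *)
pose C : R := 2 ^+ (L * size P * (M * M)).
pose G : R := \sum_(l < L) \sum_(q <- P) g l q ^+ 2.
have C0 : 0 <= C by rewrite exprn_ge0.
have G0 : 0 <= G.
  by rewrite sumr_ge0// => l _; rewrite sumr_ge0// => q _; exact: sqr_ge0.
pose T (x : 'I_L * Z2 * ('I_M * 'I_M)) k : \bar R :=
  (qnormsq (gabor N gH x k) * qnormsq (c x))%:E.
have T0 x k : (0 <= T x k)%E by rewrite lee_fin mulr_ge0 ?qnormsq_ge0.
pose H k := (C%:E * \esum_(x in [set: 'I_L * Z2 * ('I_M * 'I_M)]) T x k)%E.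
apply: (@has_usum_dominated _ _ _ _ active H).
- exact: uniq_active.
- by move=> k x /notin_active ->; rewrite mul0r.
- move=> k; rewrite big_allpairs big_allpairs big_enum /= gram_diagE mulr_sumr.
  rewrite rmorph_sum mulr_suml; apply: eq_bigr => l _ /=.
  rewrite mulr_sumr rmorph_sum mulr_suml; apply: eq_bigr => n _ /=.
  by rewrite big_enum /= gabor_reproducing.
- move=> k F; apply: (@le_trans _ _ (C%:E * \sum_(x <- active k) T x k)%E); last first.
    by rewrite lee_wpmul2l ?lee_fin// esum_ge_seq.
  rewrite sumEFin -EFinM lee_fin.
  apply: (@le_trans _ _ (2 ^+ size (active k) *
      \sum_(x <- active k) qnormsq (gabor N gH x k * c x))).
    apply: qnormsq_sum_subset => // x _; apply: contraNT => /notin_active ->.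
    by rewrite mul0r.
  under eq_bigr do rewrite qnormsqM.
  rewrite ler_wpM2r ?ler_weXn2l ?ler1n//.
  by rewrite sumr_ge0// => x _; rewrite mulr_ge0 ?qnormsq_ge0.
- rewrite esumZl// => [|k]; last exact: esum_ge0.
  apply: lte_mul_pinfty; rewrite ?lee_fin//.
  rewrite exchange_esum//.
  apply: (@le_lt_trans _ _ (\esum_(x in [set: 'I_L * Z2 * ('I_M * 'I_M)])
      (G%:E * (qnormsq (c x))%:E))%E).
    apply: le_esum => x _; rewrite [leRHS]muleC.
    under eq_esum do rewrite /T mulrC EFinM.
    rewrite esumZl ?qnormsq_ge0// => [|k]; last by rewrite lee_fin qnormsq_ge0.
    rewrite lee_wpmul2l ?lee_fin ?qnormsq_ge0// -l2normsqE.
    by case: x => [[l n] m]; exact: l2normsq_gabor_le.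
  rewrite esumZl// => [|x]; last by rewrite lee_fin qnormsq_ge0.
  apply: lte_mul_pinfty; rewrite ?lee_fin//.
  (* The coefficient sum is the frame energy, indexed by triples. *)
  have -> : \esum_(x in [set: 'I_L * Z2 * ('I_M * 'I_M)]) (qnormsq (c x))%:E =
      \esum_(k in [set: Z2]) (M%:R ^+ 2 * w k * qnormsq (h k))%:E.
    rewrite -frame_energy esum_pair => [|x]; last by rewrite lee_fin qnormsq_ge0.
    rewrite esum_pair => [|x]; last first.
      by apply: esum_ge0 => y _; rewrite lee_fin qnormsq_ge0.
    rewrite esum_fin => [|l]; last first.
      by do 2 apply: esum_ge0 => ? _; rewrite lee_fin qnormsq_ge0.
    apply: eq_bigr => l _; apply: eq_esum => n _; rewrite esum_fin => [|m].
      by apply: eq_bigr => m _; rewrite qabs_sqr.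
    by rewrite lee_fin qnormsq_ge0.
  apply: (@le_lt_trans _ _ (\esum_(k in [set: Z2])
      ((M%:R ^+ 2 * W)%:E * (qnormsq (h k))%:E))%E).
    apply: le_esum => k _; rewrite -EFinM lee_fin ler_wpM2r ?qnormsq_ge0//.
    by rewrite ler_wpM2l ?sqr_ge0.
  have W0 : 0 <= M%:R ^+ 2 * W.
    by rewrite mulr_ge0 ?sqr_ge0// (le_trans (gram_diag_ge0 0)).
  rewrite esumZl// => [|k]; last by rewrite lee_fin qnormsq_ge0.
  by rewrite lte_mul_pinfty ?lee_fin// -l2normsqE.
Qed.

Lemma frame_opE (W : R) h : (forall k, w k <= W) -> ell2 h ->
  frame_op M N gH h = fun k => qreal (M%:R ^+ 2 * w k) * h k.
Proof. by move=> wW h2; apply: usum_l2_eq; exact: frame_op_has_usum wW h2. Qed.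

Lemma gabor_frameP (A B : R) : 0 <= A -> 0 <= B ->
  gabor_frame M N gH A B <->
  forall k, A / M%:R ^+ 2 <= w k <= B / M%:R ^+ 2.
Proof.
move=> A0 B0; have M2 : 0 < M%:R ^+ 2 :> R by rewrite exprn_gt0 ?ltr0n.
split=> [frame k|bounds h _ /=].
  pose d k' : quat R := qreal (k' == k)%:R.
  have sum_d (a : Z2 -> R) : (forall k, 0 <= a k) ->
      \esum_(k' in [set: Z2]) (a k' * qnormsq (d k'))%:E = (a k)%:E.
    move=> a0; rewrite (@esum_seq _ _ [:: k])//.
    - by rewrite big_seq1 /d eqxx qnormsq_real expr1n mulr1.
    - by move=> k'; rewrite lee_fin mulr_ge0 ?qnormsq_ge0.
    - move=> k'; rewrite inE /d => /negPf ->.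
      by rewrite qnormsq_real expr0n /= mulr0.
  have l2d : l2normsq d = 1%:E.
    rewrite l2normsqE -(sum_d (fun=> 1))//.
    by apply: eq_esum => k' _; rewrite mul1r.
  have := frame d; rewrite /ell2 /= l2d frame_energy sum_d => [|k']; last first.
    by rewrite mulr_ge0 ?sqr_ge0 ?gram_diag_ge0.
  rewrite !mule1 !lee_fin ltry => /(_ isT)[Aw wB].
  by rewrite ler_pdivrMr// ler_pdivlMr// !(mulrC (w k)) Aw wB.
have h0 k : (0 <= (qnormsq (h k))%:E)%E by rewrite lee_fin qnormsq_ge0.
rewrite frame_energy l2normsqE -!esumZl//.
by split; apply: le_esum => k _; have /andP[Aw wB] := bounds k;
  rewrite -EFinM lee_fin ler_wpM2r ?qnormsq_ge0// mulrC -?ler_pdivrMr// -ler_pdivlMr.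
Qed.

End GaborSystem.

(** * Bounded multipliers, reduction modulo N, and the equivalences *)

Lemma ell2_scale (R : realType) (c : Z2 -> R) (C : R) (h : Z2 -> quat R) :
  (forall k, 0 <= c k <= C) -> ell2 h -> ell2 (fun k => qreal (c k) * h k).
Proof.
move=> cC; rewrite /ell2 /= => h2.
apply: (@le_lt_trans _ _ ((C ^+ 2)%:E * l2normsq h)%E); last first.
  by rewrite lte_mul_pinfty// lee_fin sqr_ge0.
rewrite !l2normsqE -esumZl ?sqr_ge0// => [|k]; last by rewrite lee_fin qnormsq_ge0.
apply: le_esum => k _; have /andP[c0 cleC] := cC k.
rewrite -EFinM lee_fin qnormsqM qnormsq_real ler_wpM2r ?qnormsq_ge0//.
by rewrite ler_sqr// nnegrE ?(le_trans c0).
Qed.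

Lemma Z2_modn (N : nat) (k : Z2) : (0 < N)%N ->
  exists (r : 'I_N * 'I_N) (p : Z2), k = Z2_of_ord r + p *+ N.
Proof.
move=> N0.
have mod_ord (i : int) : exists (r : 'I_N) (p : int), i = (r : nat)%:Z + p *+ N.
  have r0 : 0 <= (i %% N)%Z by rewrite modz_ge0// eqz_nat -lt0n.
  have rN : (`|(i %% N)%Z| < N)%N by rewrite -ltz_nat gez0_abs// ltz_pmod.
  exists (Ordinal rN), (i %/ N)%Z.
  by rewrite /= gez0_abs// -mulr_natr natz addrC -divz_eq.
case: k => k1 k2; have [r1 [p1 ->]] := mod_ord k1; have [r2 [p2 ->]] := mod_ord k2.
exists (r1, r2), (p1, p2); rewrite /Z2_of_ord /=.
by congr (_, _) => /=; rewrite ?(raddfMn fst) ?(raddfMn snd).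
Qed.

Theorem proposition4 (R : realType) (L M N : nat)
  (L_gt0 : (0 < L)%N) (M_gt0 : (0 < M)%N) (N_gt0 : (0 < N)%N)
  (A B : R) (A_gt0 : 0 < A) (leAB : A <= B)
  (g : 'I_L -> Z2 -> R)
  (g_fin : forall l, finite_set (supp (g l)))
  (g_len : forall l, supp_len2 (g l) < M%:Z)
  (g_diag : forall l, no_diagonal_overlap M (g l)) :
  let gH : 'I_L -> Z2 -> quat R := fun l k => qreal (g l k) in
  let w : Z2 -> R := gram_diag M N g in
  let S : (Z2 -> quat R) -> (Z2 -> quat R) := frame_op M N gH in
  let frame := gabor_frame M N gH A B in
  let bounds := forall k : Z2, A / M%:R ^+ 2 <= w k <= B / M%:R ^+ 2 in
  let bounds_period := forall k : 'I_N * 'I_N,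
    A / M%:R ^+ 2 <= w (Z2_of_ord k) <= B / M%:R ^+ 2 in
  [/\ frame <-> bounds,
      bounds <-> bounds_period
    & frame \/ bounds \/ bounds_period ->
      [/\ forall h, ell2 h -> S h = (fun k => qreal (M%:R ^+ 2 * w k) * h k),
          set_bij (@ell2 R) (@ell2 R) S
        & forall h, ell2 h -> 'pinv_(fun=> 0) (@ell2 R) S h =
                              (fun k => qreal (1 / (M%:R ^+ 2 * w k)) * h k)]].
Proof.
move=> gH w S frame bounds bounds_period.
have frameP : frame <-> bounds.
  by apply: gabor_frameP => //; rewrite ?(le_trans _ leAB)// ltW.
have periodP : bounds <-> bounds_period.
  split=> [wAB k|wAB k]; first exact: wAB.
  have [r [p ->]] := Z2_modn k N_gt0.
  by rewrite /w gram_diag_periodic//; exact: wAB.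
split; [exact: frameP | exact: periodP | move=> hyp].
have wAB : bounds by case: hyp => [/frameP|[|/periodP]].
have M2 : 0 < M%:R ^+ 2 :> R by rewrite exprn_gt0 ?ltr0n.
pose c k := M%:R ^+ 2 * w k.
have cA k : A <= c k.
  by have /andP[Aw _] := wAB k; rewrite /c mulrC -ler_pdivrMr.
have cB k : c k <= B.
  by have /andP[_ wB] := wAB k; rewrite /c mulrC -ler_pdivlMr.
have c0 k : 0 < c k by exact: lt_le_trans (cA k).
have SE h : ell2 h -> S h = fun k => qreal (c k) * h k.
  apply: (@frame_opE _ _ _ _ _ _ _ _ _ _ (B / M%:R ^+ 2)) => // k.
  by have /andP[] := wAB k.
(* The candidate inverse; it preserves l^2 because c >= A > 0 bounds its multiplier by 1 / A. *)
pose D h := fun k => qreal (1 / c k) * h k : quat R.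
have D2 h : ell2 h -> ell2 (D h).
  apply: (@ell2_scale _ _ (1 / A)) => k.
  by rewrite !div1r invr_ge0 (ltW (c0 k)) lef_pV2 ?posrE ?c0 ?cA.
have qcV k (q : quat R) : qreal (c k) * (qreal (1 / c k) * q) = q.
  by rewrite mulrA -rmorphM /= mulrC div1r mulVf ?gt_eqF// rmorph1 mul1r.
have qVc k (q : quat R) : qreal (1 / c k) * (qreal (c k) * q) = q.
  by rewrite mulrA -rmorphM /= div1r mulVf ?gt_eqF// rmorph1 mul1r.
have SD h : ell2 h -> S (D h) = h.
  by move=> h2; rewrite (SE _ (D2 _ h2)); apply/funext => k; rewrite qcV.
have Sinj : {in @ell2 R &, injective S}.
  move=> h h' /set_mem h2 /set_mem h2'; rewrite !SE// => E.
  apply/funext => k.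
  by have := congr1 (fun f => qreal (1 / c k) * f k) E; rewrite !qVc.
split; first exact: SE.
- split=> [h h2|//|h h2].
  + rewrite /= SE//; apply: (@ell2_scale _ _ B) => // k.
    by rewrite cB (ltW (c0 k)).
  + by exists (D h); [exact: D2 | exact: SD].
(* Writing h as S (D h), injectivity of [S] on l^2 lets the partial inverse cancel [S]. *)
- move=> h h2; rewrite -[in LHS](SD h h2) pinvKV//.
  by rewrite inE; exact: D2.
Qed.
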